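(* Let $T$ be a bountiful type of structure, let $(X,\leq)$ be the poset of all structures of type $T$ under the consecutive order, let $B\subseteq X$ be finite and let $C=\mathrm{Av}(B)$. Let $\Gamma_C$ be the $b$-dimensional factor graph of $C$, where $b$ is the maximum length of an element of $B$ ($b=1$ if $B=\varnothing$). The following are equivalent: (1) $C$ is well quasi-ordered under the consecutive order; (2) $C$ is finite; (3) $\Gamma_C$ contains no cycles.
   Context: Conventions: $\mathbb{N}=\{1,2,3,\dots\}$ and $[m,n]=\{m,m+1,\dots,n\}$. Structures. Fix a finite sequence of positive arities whose first entry is $2$ (the signature). A structure is a pair $(X,R)$ with $X$ a finite nonempty subset of $\mathbb{N}$ and $R$ a sequence of relations on $X$ of these arities, the first of which is the linear order on $X$ inherited from $\mathbb{N}$. Two structures of the same signature are isomorphic ($\cong$) if relabelling the points of each in increasing order by $1,2,\dots$ gives exactly the same structure; isomorphic structures are considered equal, so every structure may be taken to have underlying set $[1,n]$. Its length is $|(X,R)|=|X|$. For $Y\subseteq X$, $\sigma\upharpoonright_Y$ is the restriction of $\sigma$ to the points in $Y$; restrictions to the empty set are all regarded as isomorphic. A type of structure is a class of structures of one fixed signature satisfying some additional conditions (possibly none), closed under isomorphism and under restriction to nonempty sets of consecutive points. Consecutive order: for $\sigma,\rho$ of the same type, $\sigma\leq\rho$ iff $\sigma\cong\rho\upharpoonright_{[k,k+|\sigma|-1]}$ for some $k\ge 1$ with $k+|\sigma|-1\le|\rho|$. Valid types. Let $|\sigma|=p$, $|\rho|=q$. Then $\sigma$ and $\rho$ overlap (on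 $x$ points) if $\sigma\upharpoonright_{[p-x+1,p]}\cong\rho\upharpoonright_{[1,x]}$ for some $x\geq 1$. A structure $\theta$ of the same type with $|\theta|=p+q-x$ combines them if $\theta\upharpoonright_{[1,p]}\cong\sigma$ and $\theta\upharpoonright_{[p-x+1,p+q-x]}\cong\rho$. A type is valid if for any two structures of this type overlapping on $x$ points there is a structure of the same type combining them. Bountiful types. A valid type is bountiful if for any $m\in\mathbb{N}$ and any structures $\sigma,\rho$ of this type with $|\sigma|=|\rho|=m$ and $\sigma\upharpoonright_{[2,m]}\cong\rho\upharpoonright_{[1,m-1]}$, there exist at least two (distinct) structures $\theta_1,\theta_2$ of the type, of length $m+1$, with $\theta_i\upharpoonright_{[1,m]}\cong\sigma$ and $\theta_i\upharpoonright_{[2,m+1]}\cong\rho$ for $i=1,2$. Avoidance sets: $\mathrm{Av}(B)=\{x\in X: b'\nleq x \text{ for all } b'\in B\}$. Factor graph: for $m\ge b$, the $m$-dimensional factor graph $\Gamma_C^m$ is the digraph whose vertices are the structures in $C$ of length $m$, with an edge $u\to v$ iff $u\upharpoonright_{[2,m]}\cong v\upharpoonright_{[1,m-1]}$ (loops allowed); $\Gamma_C=\Gamma_C^b$. A cycle is a path $v_1\to\dots\to v_n$ with $v_1=v_n$ and at least one edge. A poset is well quasi-ordered (wqo) if it has neither infinite antichains nor infinite descending sequences. *)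

(* Defs.v *)
From mathcomp Require Import all_boot finmap.
From mathcomp Require Import boolp classical_sets cardinality.

Set Implicit Arguments.
Unset Strict Implicit.
Unset Printing Implicit Defensive.

Local Open Scope classical_set_scope.

(** A signature is the sequence of arities [2 :: extra]. *)
Record signature := Signature {
  extra : seq nat;
  extra_gt0 : all (fun a => 0 < a) extra
}.

Definition arity (S : signature) (i : 'I_(size (extra S)).+1) : nat :=
  nth 0 (2 :: extra S) i.

Definition relations (S : signature) (n : nat) :=
  {dffun forall i : 'I_(size (extra S)).+1, {set (arity i).-tuple 'I_n}}.

(** [arity ord0] is convertible to [2], so pairs can be used directly. *)
Definition first_is_order (S : signature) (n : nat) (R : relations S n) : bool :=
  [forall x : 'I_n, forall y : 'I_n, ([tuple x; y] \in R ord0) == (x <= y)].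

(** Structures are considered up to isomorphism: each is represented by the
    unique isomorphic one whose points are [1, ..., n], the point [j] being the
    element of ['I_n] of value [j - 1].  Isomorphism is therefore equality.
    The empty structure is admitted only as a value of restrictions; it is
    unique since all arities are positive (see [empty_structure_unique]), and
    it never belongs to a type of structure. *)
Definition structure_on (S : signature) (n : nat) :=
  {R : relations S n | first_is_order R}.

Definition structure (S : signature) := {n : nat & structure_on S n}.

Definition len (S : signature) (s : structure S) : nat := tag s.

Definition rels (S : signature) (s : structure S) : relations S (len s) :=
  val (tagged s).

Lemma empty_structure_unique (S : signature) (s t : structure S) :
  len s = 0 -> len t = 0 -> s = t.
Proof.
case: s => n [R oR]; case: t => m [Q oQ]; rewrite /len /= => n0 m0.
subst n m; congr (existT _ _ _); apply/val_inj/ffunP => i /=.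
apply/setP => t; exfalso.
have: 0 < arity i.
  rewrite /arity; case: i t => -[|i] //= ltiS t.
  exact: (allP (extra_gt0 S)) (mem_nth _ _).
by case: (arity i) t => // k t _; case: (thead t).
Qed.

(** Restriction to [Y], relabelled increasingly: [enum_val : 'I_#|Y| -> 'I_n]
    is the increasing enumeration of [Y]. *)
Definition restrict_rels (S : signature) (n : nat) (R : relations S n)
    (Y : {set 'I_n}) : relations S #|Y| :=
  [ffun i => [set t : (arity i).-tuple 'I_#|Y| |
               map_tuple (@enum_val _ (mem Y)) t \in R i]%SET].

Lemma leq_enum_val (n : nat) (Y : {set 'I_n}) (x y : 'I_#|Y|) :
  (enum_val x <= enum_val y) = (x <= y).
Proof.
have sY : sorted ltn (map val (enum Y)).
  rewrite -[enum _](eq_filter (mem_enum _)).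
  rewrite -(eq_filter (mem_map val_inj _)) -filter_map.
  by rewrite (sorted_filter ltn_trans) // unlock val_ord_enum iota_ltn_sorted.
have ltY (u v : 'I_#|Y|) : u < v -> enum_val u < enum_val v.
  move=> ltuv; pose x0 : 'I_n := enum_val u.
  have szY (w : 'I_#|Y|) : w < size (enum Y) by rewrite -cardE.
  rewrite !(enum_val_nth x0) -!(nth_map x0 0 val) ?szY //.
  have := sorted_ltn_nth ltn_trans 0 sY.
  by move=> /(_ (val u) (val v)); rewrite !inE size_map !szY; apply.
case: (ltngtP x y) => [/ltY/ltnW //|/ltY|/val_inj->]; last exact: leqnn.
by rewrite ltnNge => /negbTE.
Qed.

Lemma restrict_subproof (S : signature) (n : nat) (R : relations S n)
    (Y : {set 'I_n}) :
  first_is_order R -> first_is_order (restrict_rels R Y).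
Proof.
move=> /forallP oR; apply/forallP => x; apply/forallP => y.
have /forallP/(_ (enum_val y))/eqP oxy := oR (enum_val x).
rewrite ffunE inE -(leq_enum_val x y) -oxy.
have -> : map_tuple (@enum_val _ (mem Y)) [tuple x; y] =
          [tuple enum_val x; enum_val y] by exact: val_inj.
exact: eqxx.
Qed.

Definition restrict (S : signature) (s : structure S)
    (Y : {set 'I_(len s)}) : structure S :=
  existT (structure_on S) #|Y|
    (exist _ (restrict_rels (rels s) Y)
             (restrict_subproof Y (valP (tagged s)))).

(** Restriction to the points of [s] numbered [a, ..., b], numbering from 1. *)
Definition restr (S : signature) (s : structure S) (a b : nat) : structure S :=
  restrict [set i : 'I_(len s) | a <= i.+1 <= b]%SET.

Definition is_type (S : signature) (T : set (structure S)) : Prop :=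
  (forall s, T s -> 0 < len s) /\
  (forall s a b, T s -> 1 <= a -> a <= b -> b <= len s -> T (restr s a b)).

Definition consecutive_le (S : signature) (s r : structure S) : Prop :=
  exists k, [/\ 1 <= k, k + len s - 1 <= len r &
                s = restr r k (k + len s - 1)].

Definition overlap (S : signature) (x : nat) (s r : structure S) : Prop :=
  [/\ 1 <= x, x <= len s, x <= len r &
      restr s (len s - x + 1) (len s) = restr r 1 x].

Definition combines (S : signature) (x : nat) (s r t : structure S) : Prop :=
  [/\ len t = len s + len r - x,
      restr t 1 (len s) = s &
      restr t (len s - x + 1) (len s + len r - x) = r].

Definition valid (S : signature) (T : set (structure S)) : Prop :=
  is_type T /\
  forall s r x, T s -> T r -> overlap x s r -> exists2 t, T t & combines x s r t.

Definition bountiful (S : signature) (T : set (structure S)) : Prop :=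
  valid T /\
  forall m s r, 1 <= m -> T s -> T r -> len s = m -> len r = m ->
    restr s 2 m = restr r 1 (m - 1) ->
    exists t1 t2, t1 <> t2 /\
      forall t, t = t1 \/ t = t2 ->
        [/\ T t, len t = m + 1, restr t 1 m = s & restr t 2 (m + 1) = r].

Definition Av (S : signature) (T : set (structure S)) (B : {fset structure S})
    : set (structure S) :=
  [set s | T s /\ forall b, b \in B -> ~ consecutive_le b s].

Definition max_len (S : signature) (B : {fset structure S}) : nat :=
  if B == fset0 then 1 else \max_(b <- B) len b.

Record digraph (V : Type) := Digraph {
  vertex : set V;
  edge : V -> V -> Prop
}.

(** A cycle [v 0 -> ... -> v n = v 0]; its vertices need not be distinct. *)
Definition has_cycle (V : Type) (G : digraph V) : Prop :=
  exists (n : nat) (v : nat -> V),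
    [/\ 1 <= n,
        forall i, i <= n -> vertex G (v i),
        forall i, i < n -> edge G (v i) (v i.+1) &
        v 0 = v n].

Definition factor_graph (S : signature) (C : set (structure S)) (m : nat)
    : digraph (structure S) :=
  Digraph [set s | C s /\ len s = m]
          (fun u v => restr u 2 m = restr v 1 (m - 1)).

Definition antichain (X : Type) (le : X -> X -> Prop) (A : set X) : Prop :=
  forall x y, A x -> A y -> le x y -> x = y.

(** The subset [C] of the poset [(X, le)], with the induced order, is wqo. *)
Definition wqo (X : Type) (le : X -> X -> Prop) (C : set X) : Prop :=
  (forall A : set X, A `<=` C -> antichain le A -> finite_set A) /\
  ~ (exists f : nat -> X,
       forall i, [/\ C (f i), le (f i.+1) (f i) & f i.+1 <> f i]).

(* Main.v *)
Require Import Defs.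
From mathcomp Require Import all_boot finmap.
From mathcomp Require Import boolp classical_sets cardinality.
From mathcomp Require Import zify.

Set Implicit Arguments.
Unset Strict Implicit.
Unset Printing Implicit Defensive.

Local Open Scope classical_set_scope.

(** The three conditions are proved equivalent by the implications
    (1) => no cycle => finite => (1).

    Write [m] for the dimension of the factor graph.  A structure of length at
    least [m] avoids [B] as soon as all its factors of length [m] do, because
    no element of [B] is longer than [m] ([Av_of_factors]).

    A cycle gives an infinite antichain ([not_wqo_of_cycle]).  Unroll the cycle
    into an infinite periodic walk.  Bountifulness provides, for each edge of
    the walk, two different structures of length [m + 1] having the two ends of
    the edge as their factors of length [m]; select one as the plain label of
    the edge and the other as its marked label.  Validity glues any sequence of
    labels of consecutive edges into one structure ([glue_factors]).  For each
    [k >= 1], go [k] times around the cycle and once more along its first edge,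
    using the marked label for the first and last edges only.  The marked label
    of the first edge is not the plain label of any edge: a label
    determines its edge, and the two labels of one edge differ.  Thus it occurs
    in the [k]-th structure exactly twice, at distance [k] times the length of
    the cycle, and this distance is preserved by embeddings; so no two of these
    structures are comparable.

    If [C] is infinite, it contains arbitrarily long structures, since there
    are finitely many of each length.  The factors of length [m] of a structure
    of [C] form a walk in the finite factor graph, and a walk with more steps
    than there are vertices contains a cycle ([cycle_of_long_structure]).

    Finally, a strictly descending sequence of structures has strictly
    decreasing lengths, so a finite [C] is well quasi-ordered. *)

(** * Structures as relations on natural numbers *)

(** Tuples over ['I_n] are replaced by sequences of naturals, so that structures
    whose lengths are equal but not convertible can be compared without casts. *)
Definition holds (S : signature) (s : structure S) i (l : seq nat) : bool :=
  [exists t in rels s i, map val (tval t) == l].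

Lemma holds_map_val (S : signature) (s : structure S) i
    (t : (arity i).-tuple 'I_(len s)) :
  holds s i (map val t) = (t \in rels s i).
Proof.
apply/existsP/idP => [[u /andP[Ru /eqP eq_ut]]|Rt]; last first.
  by exists t; rewrite Rt eqxx.
by have -> : t = u by apply/val_inj/(inj_map val_inj)/esym.
Qed.

Lemma structure_eq (S : signature) (s r : structure S) :
  len s = len r -> (forall i l, holds s i l = holds r i l) -> s = r.
Proof.
case: s => n [R oR]; case: r => p [Q oQ]; rewrite /len /= => np.
subst p => eq_holds; congr (existT _ _ _); apply/val_inj/ffunP => i /=.
apply/setP => t.
by have := eq_holds i (map val t); rewrite !holds_map_val.
Qed.

(** * Factors *)

(** Restriction to [n] consecutive points after skipping [a]: positions count
    from 0 here, so that positions add up under iterated restriction. *)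
Definition factor (S : signature) (s : structure S) (a n : nat) :=
  restr s a.+1 (a + n).

Lemma restrE (S : signature) (s : structure S) (a b : nat) :
  0 < a -> a <= b.+1 -> restr s a b = factor s a.-1 (b.+1 - a).
Proof.
by move=> a0 ab; rewrite /factor; congr restr; lia.
Qed.

Lemma val_enum_interval (n a k : nat) : a + k <= n ->
  map val (enum [set i : 'I_n | a.+1 <= i.+1 <= a + k]%SET) = iota a k.
Proof.
move=> le_n; set Y := (X in enum X).
have -> : map val (enum Y) = [seq i <- iota 0 n | a <= i < a + k].
  rewrite -val_enum_ord filter_map enumT; congr map.
  by rewrite /enum_mem; apply: eq_filter => i; rewrite /= inE.
apply: (irr_sorted_eq ltn_trans ltnn); rewrite ?iota_ltn_sorted //.
  by rewrite (sorted_filter ltn_trans) // iota_ltn_sorted.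
by move=> i; rewrite mem_filter !mem_iota; lia.
Qed.

Lemma len_factor (S : signature) (s : structure S) (a n : nat) :
  a + n <= len s -> len (factor s a n) = n.
Proof.
move=> le_s; rewrite /len /= cardE.
by rewrite -(size_map val) val_enum_interval ?size_iota.
Qed.

Lemma seq_ord_of_nat (n : nat) (l : seq nat) :
  all (gtn n) l -> exists u : seq 'I_n, map val u = l.
Proof.
elim: l => [|x l IHl] /=; first by exists [::].
by case/andP=> ltx /IHl[u <-]; exists (Ordinal ltx :: u).
Qed.

Lemma holds_factor (S : signature) (s : structure S) (a n : nat) i l :
  a + n <= len s ->
  holds (factor s a n) i l = all (gtn n) l && holds s i (map (addn a) l).
Proof.
move=> le_s; have lenE := len_factor le_s.
set Y := [set i : 'I_(len s) | a.+1 <= i.+1 <= a + n]%SET.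
have cardY : #|Y| = n by rewrite -[RHS]lenE.
have enumY (x : 'I_#|Y|) : val (enum_val x) = a + x.
  rewrite (enum_val_nth (enum_val x)) -(nth_map _ 0) -?cardE //.
  by rewrite val_enum_interval // nth_iota -?cardY.
have map_enumY (t : seq 'I_#|Y|) :
    map val (map (@enum_val _ (mem Y)) t) = map (addn a) (map val t).
  by rewrite -!map_comp; apply: eq_map => x /=; rewrite enumY.
apply/existsP/andP => [[t /andP[Rt /eqP<-]]|].
  split; first by apply/allP => _ /mapP[x _ ->] /=; rewrite -[X in _ < X]lenE.
  apply/existsP; exists (map_tuple (@enum_val _ (mem Y)) t).
  by move: Rt; rewrite /rels /= ffunE inE => ->; rewrite map_enumY /=.
case=> ltl /existsP[t /andP[Rt /eqP tl]].
have [u ul] : exists u : seq 'I_#|Y|, map val u = l.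
  by apply: seq_ord_of_nat; rewrite cardY.
have size_u : size u == arity i.
  by rewrite -(size_map val) ul -(size_map (addn a)) -tl size_map size_tuple.
exists (Tuple size_u); rewrite /= ul eqxx andbT /rels /= ffunE inE.
suff -> : map_tuple (@enum_val _ (mem Y)) (Tuple size_u) = t by [].
by apply/val_inj/(inj_map val_inj); rewrite /= tl map_enumY ul.
Qed.

Lemma factor_factor (S : signature) (s : structure S) (a n c k : nat) :
  a + n <= len s -> c + k <= n ->
  factor (factor s a n) c k = factor s (a + c) k.
Proof.
move=> le_s le_n; have lenE := len_factor le_s.
apply: structure_eq => [|i l]; first by rewrite !len_factor ?lenE //; lia.
rewrite !holds_factor ?lenE //; last lia.
have -> : map (addn a) (map (addn c) l) = map (addn (a + c)) l.
  by rewrite -map_comp; apply: eq_map => x /=; rewrite addnA.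
rewrite andbA -[in RHS](andbb (all _ l)); congr (_ && _).
have [/allP ltl|//] := boolP (all (gtn k) l).
by rewrite all_map; apply/allP => x /ltl /=; lia.
Qed.

Lemma factor_full (S : signature) (s : structure S) : factor s 0 (len s) = s.
Proof.
apply: structure_eq => [|i l]; first by rewrite len_factor.
rewrite holds_factor // map_id.
have [//|ltl] := boolP (all _ l).
apply/esym/negbTE/negP => /existsP[t /andP[_ /eqP tl]].
by move/negP: ltl; apply; rewrite -tl; apply/allP => _ /mapP[x _ ->] /=.
Qed.

Lemma consecutive_leP (S : signature) (s r : structure S) : 0 < len s ->
  consecutive_le s r <->
  exists2 p, p + len s <= len r & s = factor r p (len s).
Proof.
move=> s0; split=> [[k [k1 le_r eq_s]]|[p le_r eq_s]].
  exists k.-1; first lia.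
  rewrite {1}eq_s restrE //; last lia.
  by congr factor; lia.
exists p.+1; split; [lia| lia |rewrite {1}eq_s /factor; congr restr; lia].
Qed.

(** * Avoidance sets *)

Lemma max_len_gt0 (S : signature) (T : set (structure S)) (B : {fset structure S}) :
  (forall s, T s -> 0 < len s) -> (forall s : structure S, s \in B -> T s) -> 0 < max_len B.
Proof.
move=> T0 BT; rewrite /max_len; case: eqP => // /eqP/fset0Pn[s Bs].
by apply: leq_trans (T0 s (BT s Bs)) _; apply: leq_bigmax_seq.
Qed.

Lemma len_le_max_len (S : signature) (B : {fset structure S}) s :
  s \in B -> len s <= max_len B.
Proof.
move=> Bs; rewrite /max_len; case: eqP => [B0|_].
  by rewrite B0 in_fset0 in Bs.
exact: leq_bigmax_seq.
Qed.

Section Avoidance.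

Variables (S : signature) (T : set (structure S)) (B : {fset structure S}).
Hypotheses (bountifulT : bountiful T) (BT : forall s : structure S, s \in B -> T s).

Let m := max_len B.

Let T_gt0 s (Ts : T s) : 0 < len s := proj1 (proj1 (proj1 bountifulT)) s Ts.

Let m_gt0 : 0 < m := max_len_gt0 T_gt0 BT.

Lemma T_factor s a n : T s -> 0 < n -> a + n <= len s -> T (factor s a n).
Proof.
move=> Ts n0 le_s.
by apply: (proj2 (proj1 (proj1 bountifulT))) => //; lia.
Qed.

Lemma Av_factor s a n :
  Av T B s -> 0 < n -> a + n <= len s -> Av T B (factor s a n).
Proof.
move=> [Ts avs] n0 le_s; split; first exact: T_factor.
move=> c Bc /consecutive_leP[|p]; first exact/T_gt0/BT.
rewrite len_factor // => le_n eq_c; apply: (avs c Bc).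
apply/consecutive_leP; first exact/T_gt0/BT.
by exists (a + p); rewrite -?(@factor_factor _ _ _ n) //; lia.
Qed.

Lemma Av_of_factors s : T s -> m <= len s ->
  (forall a, a + m <= len s -> Av T B (factor s a m)) -> Av T B s.
Proof.
move=> Ts le_s av; split=> // c Bc.
have c0 : 0 < len c by exact/T_gt0/BT.
have le_m : len c <= m := len_le_max_len Bc.
move=> /consecutive_leP[//|p le_p eq_c].
(* Near the right end, the length-m factor starting at p does not fit and the
   last factor of length m is used instead. *)
pose q := minn p (len s - m); have le_q : q + m <= len s by lia.
case: (av q le_q) => _ /(_ c Bc); apply; apply/consecutive_leP => //.
exists (p - q); first by rewrite len_factor //; lia.
by rewrite factor_factor //; [rewrite {1}eq_c; congr factor; lia | lia].
Qed.

(** * Gluing *)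

(** Each step appends one point, by combining the structure obtained so far
    with the next prescribed factor along their common [n] points. *)
Lemma glue_factors (n : nat) (w : nat -> structure S) : 0 < n ->
  (forall i, T (w i)) -> (forall i, len (w i) = n.+1) ->
  (forall i, factor (w i) 1 n = factor (w i.+1) 0 n) ->
  forall k, exists s, [/\ T s, len s = n.+1 + k &
    forall i, i <= k -> factor s i n.+1 = w i].
Proof.
move=> n0 Tw lenw glue; elim=> [|k [s [Ts lens facs]]].
  exists (w 0); split; rewrite ?lenw ?addn0 // => i.
  by rewrite leqn0 => /eqP->; rewrite -[RHS]factor_full lenw.
have lenwk := lenw k.+1; have ov : overlap n s (w k.+1).
  split; rewrite ?lens ?lenw //; try lia.
  rewrite !restrE; try lia.
  transitivity (factor (w k) 1 n); last by rewrite glue; congr factor; lia.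
  rewrite -(facs k) // factor_factor; try lia.
  by congr factor; lia.
have [t Tt [lent t_s t_w]] := proj2 (proj1 bountifulT) _ _ _ Ts (Tw k.+1) ov.
exists t; split=> //; first by rewrite lent lens lenw; lia.
move=> i; rewrite leq_eqVlt => /predU1P[->|ltik].
  rewrite -[RHS]t_w lens lenw restrE; try lia.
  by congr factor; lia.
rewrite -(facs i) // -t_s restrE; try lia.
rewrite factor_factor; try lia.
by congr factor; lia.
Qed.

(** * Cycles and infinite antichains *)

(** The ends of an edge may occur several times in the given closed walk, so the
    two labels attached to an edge have to differ from the labels of all other
    edges.  They do, because the two factors of length [m] of a label are the
    ends of its edge; this is why the cycle need not be simple. *)
Lemma not_wqo_of_cycle :
  has_cycle (factor_graph (Av T B) m) -> ~ wqo (@consecutive_le S) (Av T B).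
Proof.
move=> [n [v [n0 Vv Ev v0n]]] [anti _].
pose u i := v (i %% n).
have Vu i : Av T B (u i) /\ len (u i) = m.
  by apply: Vv; apply/ltnW; rewrite ltn_mod.
have Eu i : restr (u i) 2 m = restr (u i.+1) 1 (m - 1).
  have ltin : i %% n < n by rewrite ltn_mod.
  rewrite (Ev _ ltin) /u -[in RHS]addn1 -modnDml addn1.
  have [lt|lt|->] := ltngtP (i %% n).+1 n; first by rewrite (modn_small lt).
    by move: ltin; rewrite leqNgt lt.
  by rewrite modnn v0n.
pose label i t :=
  [/\ T t, len t = m.+1, factor t 0 m = u i & factor t 1 m = u i.+1].
(* The labels are chosen as functions of the edge, not of its place in the
   walk: the plain label of a repeated edge must be the same at each visit. *)
have /choice[lab labP] (e : structure S * structure S) :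
    exists t : structure S * structure S,
    t.1 <> t.2 /\ forall i, e = (u i, u i.+1) -> label i t.1 /\ label i t.2.
  have [[i ei]|noi] := pselect (exists i, e = (u i, u i.+1)); last first.
    have [t1 [t2 [neq _]]] := proj2 bountifulT m _ _ m_gt0
      (proj1 (proj1 (Vu 0))) (proj1 (proj1 (Vu 1)))
      (proj2 (Vu 0)) (proj2 (Vu 1)) (Eu 0).
    by exists (t1, t2); split=> // i ei; case: noi; exists i.
  have [t1 [t2 [neq tP]]] := proj2 bountifulT m _ _ m_gt0
    (proj1 (proj1 (Vu i))) (proj1 (proj1 (Vu i.+1)))
    (proj2 (Vu i)) (proj2 (Vu i.+1)) (Eu i).
  exists (t1, t2); split=> // j ej.
  have [uij uij1] : u i = u j /\ u i.+1 = u j.+1 by move: ej; rewrite ei => -[].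
  have lb t : t = t1 \/ t = t2 -> label j t.
    move=> /tP[Tt lent t1m t2m]; split=> //; first by rewrite lent addn1.
      by rewrite -uij -[RHS]t1m.
    by rewrite -uij1 -[RHS]t2m restrE; [congr factor; lia | lia | lia].
  by split; apply: lb; [left|right].
pose plain i := (lab (u i, u i.+1)).1.
pose mark := (lab (u 0, u 1)).2.
have plainP i : label i (plain i) by have [_ /(_ i erefl)[]] := labP (u i, u i.+1).
have markP i : u i = u 0 -> u i.+1 = u 1 -> label i mark.
  move=> ui ui1; have [_ /(_ i)[]//] := labP (u 0, u 1).
  by rewrite ui ui1.
have mark_neq i : mark <> plain i.
  move=> eqm; have [_ _ m0 m1] := markP 0 erefl erefl.
  have [_ _ p0 p1] := plainP i.
  have [+ _] := labP (u 0, u 1); apply; rewrite -/mark eqm /plain.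
  by rewrite -p0 -p1 -eqm m0 m1.
pose w k i := if (i == 0) || (i == k * n) then mark else plain i.
have wP k i : label i (w k i).
  rewrite /w; case: ifP => // /orP[]/eqP->; first exact: markP.
  by apply: markP; rewrite /u -?[(k * n).+1]addn1 ?modnMl ?mod0n ?modnMDl.
have /choice[s sP] k : exists s, [/\ T s, len s = m.+1 + k * n &
    forall i, i <= k * n -> factor s i m.+1 = w k i].
  apply: glue_factors => // i; try by case: (wP k i).
  by have [_ _ _ ->] := wP k i; have [_ _ -> _] := wP k i.+1.
have av_s k : Av T B (s k).
  have [Ts lens facs] := sP k.
  apply: Av_of_factors => // [|a le_a]; first lia.
  have [le_ak|lt_ka] := leqP a (k * n).
    have -> : factor (s k) a m = u a.
      have [_ _ <- _] := wP k a.
      by rewrite -facs // factor_factor; [rewrite addn0 | lia | lia].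
    by case: (Vu a).
  have -> : factor (s k) a m = u (k * n).+1.
    have [_ _ _ <-] := wP k (k * n).
    by rewrite -facs // factor_factor; [congr factor; lia | lia | lia].
  by case: (Vu (k * n).+1).
have w_mark k i : w k i = mark -> i = 0 \/ i = k * n.
  rewrite /w; case: ifP => [/orP[]/eqP->|_ /esym/mark_neq//]; by [left|right].
have s_le j k : consecutive_le (s j.+1) (s k.+1) -> j = k.
  have [Tj lenj facj] := sP j.+1; have [Tk lenk fack] := sP k.+1.
  move=> /consecutive_leP[|p le_p eq_s]; first exact: T_gt0.
  have markk i : i <= j.+1 * n -> w j.+1 i = mark -> w k.+1 (p + i) = mark.
    move=> le_i <-; rewrite -facj // -fack; last lia.
    by rewrite eq_s factor_factor //; lia.
  have /w_mark P0 : w k.+1 (p + 0) = mark by apply: markk.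
  have /w_mark P1 : w k.+1 (p + j.+1 * n) = mark.
    by apply: markk => //; rewrite /w eqxx orbT.
  have : j.+1 * n = k.+1 * n by lia.
  by move/eqP; rewrite eqn_pmul2r // => /eqP[].
have : finite_set (range (fun k => s k.+1)).
  apply: anti => [_ [k _ <-]|_ _ [j _ <-] [k _ <-] /s_le-> //].
  exact: av_s.
move=> /finite_preimage fin; apply: infinite_nat.
apply: sub_finite_set (fin _ (fun k => s k.+1) _) => [k _|j k _ _ eq_s].
  by exists k.
apply: s_le; rewrite eq_s; apply/consecutive_leP.
  exact: T_gt0 (proj1 (av_s _)).
by exists 0; rewrite ?factor_full.
Qed.

(** * Long structures and cycles *)

Definition structures_of_len (n : nat) : seq (structure S) :=
  [seq existT (structure_on S) n R | R <- enum {: structure_on S n}].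

Lemma mem_structures_of_len s : s \in structures_of_len (len s).
Proof. by case: s => n R; apply: map_f; rewrite mem_enum. Qed.

(** Pigeonhole: the length of [s] makes the number of its factors of length [m]
    exceed the number of structures of length [m]; the factors lying between two
    equal ones form a closed walk. *)
Lemma cycle_of_long_structure s : Av T B s ->
  m + size (structures_of_len m) <= len s ->
  has_cycle (factor_graph (Av T B) m).
Proof.
set N := size _ => avs le_s.
pose v i := factor s i m.
have lenv i : i <= N -> len (v i) = m by move=> ?; rewrite len_factor //; lia.
have : ~~ uniq (mkseq v N.+1).
  apply/negP => /(@uniq_leq_size _ _ (structures_of_len m)).
  rewrite size_mkseq ltnn => le_N; suff: false by []; apply: le_N => x.
  case/mapP=> i; rewrite mem_iota => /andP[_ lt_i] ->.
  by rewrite -(lenv i) // mem_structures_of_len.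
case/(uniqPn s) => i [j []]; rewrite size_mkseq => lt_ij lt_jN.
rewrite !nth_mkseq //; last lia.
move=> eq_v; exists (j - i), (fun k => v (i + k)); split.
- lia.
- by move=> k le_k; split; [apply: Av_factor => //; lia | apply: lenv; lia].
- move=> k lt_k; rewrite /= !restrE //; try lia.
  rewrite !factor_factor; try lia.
  by congr factor; lia.
- by rewrite addn0 subnKC // ltnW.
Qed.

Lemma finite_of_acyclic :
  ~ has_cycle (factor_graph (Av T B) m) -> finite_set (Av T B).
Proof.
move=> acyclic; pose M := m + size (structures_of_len m).
apply: (@sub_finite_set _ _ [set` flatten (map structures_of_len (iota 0 M))]).
  move=> s avs /=; apply/flattenP; exists (structures_of_len (len s)).
    apply: map_f; rewrite mem_iota /= ltnNge; apply/negP => le_s.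
    by apply: acyclic; apply: cycle_of_long_structure le_s.
  exact: mem_structures_of_len.
exact: finite_seq.
Qed.

(** * Well quasi-order of finite sets *)

Lemma wqo_of_finite : finite_set (Av T B) -> wqo (@consecutive_le S) (Av T B).
Proof.
move=> fin; split=> [A subA _|[f fP]]; first exact: sub_finite_set fin.
have Tf i : T (f i) by have [[]] := fP i.
have lt_len i : len (f i.+1) < len (f i).
  have [_ + neq] := fP i.
  move=> /consecutive_leP[|p le_p eq_f]; first exact: T_gt0.
  rewrite ltn_neqAle; apply/andP; split; last lia.
  apply/eqP => eq_len; apply: neq; rewrite eq_f eq_len.
  by have -> : p = 0 by [lia]; apply: factor_full.
have bound i : len (f i) + i <= len (f 0).
  by elim: i => [|i IHi]; [rewrite addn0 | have := lt_len i; lia].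
by have := bound (len (f 0)).+1; lia.
Qed.

End Avoidance.

Theorem theorem7p3 (S : signature) (T : set (structure S))
    (bountifulT : bountiful T) (B : {fset structure S})
    (subBT : forall s : structure S, s \in B -> T s) :
  (wqo (@consecutive_le S) (Av T B) <-> finite_set (Av T B)) /\
  (finite_set (Av T B) <-> ~ has_cycle (factor_graph (Av T B) (max_len B))).
Proof.
have wqo_acyclic : wqo (@consecutive_le S) (Av T B) ->
    ~ has_cycle (factor_graph (Av T B) (max_len B)).
  by move=> wqoC /not_wqo_of_cycle; apply.
have acyclic_finite := @finite_of_acyclic S T B bountifulT.
have finite_wqo := @wqo_of_finite S T B bountifulT.
by split; split; auto.
Qed.
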